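(* Let $\mathcal{H}$ be a complex Hilbert space. For each $n\in\mathbb{N}$, let $\sigma_n$ be a connection on $B(\mathcal{H})^+$ with representing function $f_n$ and representing measure $\mu_n$. Then the following are equivalent for a connection $\sigma$ on $B(\mathcal{H})^+$ with representing function $f$ and representing measure $\mu$: (i) $\sigma_n\to\sigma$ in $C(B(\mathcal{H})^+)$; (ii) $f_n\to f$ in $OM(\mathbb{R}^+)$; (iii) $\mu_n\to\mu$ in $BM([0,\infty])$. Here convergence is with respect to the topology induced on each of these normed cones by the pseudometric $d(x,y)=\big|\|x\|-\|y\|\big|$.
   Context: $B(\mathcal{H})$ is the algebra of bounded linear operators on $\mathcal{H}$, $B(\mathcal{H})^+$ its set of positive (semidefinite) operators, $\leqslant$ the usual order on Hermitian operators, $\mathbb{R}^+=[0,\infty)$. A connection on $B(\mathcal{H})^+$ (in the sense of Kubo and Ando) is a binary operation $\sigma: B(\mathcal{H})^+\times B(\mathcal{H})^+\to B(\mathcal{H})^+$ such that for all $A,B,C,D\geqslant 0$: (M1) $A\leqslant C$, $B\leqslant D$ imply $A\,\sigma\,B\leqslant C\,\sigma\,D$; (M2) $C(A\,\sigma\,B)C\leqslant (CAC)\,\sigma\,(CBC)$; (M3) if $A_n\downarrow A$ and $B_n\downarrow B$ in $B(\mathcal{H})^+$ (decreasing sequences converging strongly), then $A_n\,\sigma\,B_n\downarrow A\,\sigma\,B$. $C(B(\mathcal{H})^+)$ is the set of connections, a cone under $A\,(\sigma+\eta)\,B=(A\,\sigma\,B)+(A\,\eta\,B)$ and $A\,(k\sigma)\,B=k(A\,\sigma\,B)$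 for $k\in\mathbb{R}^+$, with norm $\|\sigma\|=\sup\{\|A\,\sigma\,B\|: A,B\geqslant0,\ \|A\|=\|B\|=1\}$. A continuous real function $f$ on an interval $J$ is operator monotone if for every Hilbert space $\mathcal{K}$ and all Hermitian $A,B\in B(\mathcal{K})$ with spectra in $J$, $A\leqslant B$ implies $f(A)\leqslant f(B)$. $OM(\mathbb{R}^+)$ is the cone of operator monotone functions $\mathbb{R}^+\to\mathbb{R}^+$, with norm $\|f\|=f(1)$. $BM([0,\infty])$ is the cone of finite (positive) Borel measures on $[0,\infty]$, with norm $\|\mu\|=\mu([0,\infty])$. Cited from Kubo and Ando: for each connection $\sigma$ there is a unique $f\in OM(\mathbb{R}^+)$ with $f(x)I=I\,\sigma\,(xI)$ for all $x\in\mathbb{R}^+$, called the representing function of $\sigma$; and there is a unique $\mu\in BM([0,\infty])$ with $A\,\sigma\,B=\int_{[0,\infty]}\frac{\lambda+1}{2\lambda}(\lambda A\,!\,B)\,d\mu(\lambda)$ for all $A,B\geqslant0$, called the representing measure of $\sigma$. Here $A\,!\,B=2(A^{-1}+B^{-1})^{-1}$ for invertible $A,B$ (in general, the strong limit of $(A+\epsilon I)\,!\,(B+\epsilon I)$ as $\epsilon\downarrow0$), the integrand is interpreted as its limit at the endpoints, namely $A$ at $\lambda=0$ and $B$ at $\lambda=\infty$, and the integral is understood in the weak sense. *)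

(* Defs.v *)
From HB Require Import structures.
From mathcomp Require Import all_boot all_order all_algebra.
From mathcomp Require Import sesquilinear complex.
From mathcomp Require Import all_classical all_reals all_analysis.
From mathcomp Require Import measurable_realfun.

Set Implicit Arguments.
Unset Strict Implicit.
Unset Printing Implicit Defensive.

Import Order.TTheory GRing.Theory Num.Theory.
Import numFieldNormedType.Exports.

Local Open Scope classical_set_scope.
Local Open Scope complex_scope.
Local Open Scope ring_scope.

(* The inner product is linear in its first argument, as in [sesquilinear]. *)
HB.mixin Record isHilbert (R : realType) (H : Type)
    & CompleteNormedModule R[i] H := {
  hdot : {dot H for @Num.conj R[i]} ;
  hdot_norm : forall x : H, `|x| ^+ 2 = hdot x x
}.

#[short(type="hilbertType")]
HB.structure Definition Hilbert (R : realType) :=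
  {H of CompleteNormedModule R[i] H & isHilbert R H}.

Record bop (R : realType) (H : hilbertType R) := Bop {
  bop_fun :> {linear H -> H} ;
  bop_continuous : continuous bop_fun
}.

Section BopAlgebra.
Variables (R : realType) (H : hilbertType R).
Implicit Types (A B C : bop H) (a b : R[i]).

HB.instance Definition _ := gen_eqMixin (bop H).
HB.instance Definition _ := gen_choiceMixin (bop H).

Lemma bopP A B : (forall x, A x = B x) -> A = B.
Proof.
case: A B => [f cf] [g cg] /= fg.
have e : f = g.
  case: f cf fg => f [[p1] [p2]] cf; case: g cg => g [[q1] [q2]] cg /= fg.
  have e : f = g by apply/funext.
  case: g / e q1 q2 cg fg => q1 q2 _ _.
  by rewrite (Prop_irrelevance p1 q1) (Prop_irrelevance p2 q2).
by case: g / e cg fg => cg _; rewrite (Prop_irrelevance cf cg).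
Qed.

Fact bop0_continuous : continuous (\0 : {linear H -> H}).
Proof. by move=> x; apply: cvg_cst. Qed.
Definition bop0 : bop H := Bop bop0_continuous.

Fact bop1_continuous : continuous (idfun : {linear H -> H}).
Proof. by move=> x; apply: cvg_id. Qed.
Definition bop1 : bop H := Bop bop1_continuous.

Fact bop_add_continuous A B : continuous (A \+ B : {linear H -> H}).
Proof. by move=> x; apply: cvgD; apply: bop_continuous. Qed.
Definition bop_add A B : bop H := Bop (@bop_add_continuous A B).

Fact bop_opp_continuous A : continuous (\- A : {linear H -> H}).
Proof. by move=> x; apply: cvgN; apply: bop_continuous. Qed.
Definition bop_opp A : bop H := Bop (@bop_opp_continuous A).

Fact bop_scale_continuous a A : continuous (a \*: A : {linear H -> H}).
Proof. by move=> x; apply: cvgZl_tmp; apply: bop_continuous. Qed.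
Definition bop_scale a A : bop H := Bop (@bop_scale_continuous a A).

Fact bop_mul_continuous A B : continuous (A \o B : {linear H -> H}).
Proof.
by move=> x; apply: continuous_comp; apply: bop_continuous.
Qed.
Definition bop_mul A B : bop H := Bop (@bop_mul_continuous A B).

Fact bop_addA : associative bop_add.
Proof. by move=> A B C; apply: bopP => x /=; rewrite addrA. Qed.
Fact bop_addC : commutative bop_add.
Proof. by move=> A B; apply: bopP => x /=; rewrite addrC. Qed.
Fact bop_add0 : left_id bop0 bop_add.
Proof. by move=> A; apply: bopP => x /=; rewrite add0r. Qed.
Fact bop_addN : left_inverse bop0 bop_opp bop_add.
Proof. by move=> A; apply: bopP => x /=; rewrite addNr. Qed.
HB.instance Definition _ :=
  GRing.isZmodule.Build (bop H) bop_addA bop_addC bop_add0 bop_addN.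

Fact bop_mulA : associative bop_mul.
Proof. by move=> A B C; apply: bopP. Qed.
Fact bop_mul1l : left_id bop1 bop_mul.
Proof. by move=> A; apply: bopP. Qed.
Fact bop_mul1r : right_id bop1 bop_mul.
Proof. by move=> A; apply: bopP. Qed.
Fact bop_mulDl : left_distributive bop_mul +%R.
Proof. by move=> A B C; apply: bopP. Qed.
Fact bop_mulDr : right_distributive bop_mul +%R.
Proof. by move=> A B C; apply: bopP => x /=; rewrite linearD. Qed.
HB.instance Definition _ := GRing.Zmodule_isPzRing.Build (bop H)
  bop_mulA bop_mul1l bop_mul1r bop_mulDl bop_mulDr.

Fact bop_scaleA a b A : bop_scale a (bop_scale b A) = bop_scale (a * b) A.
Proof. by apply: bopP => x /=; rewrite scalerA. Qed.
Fact bop_scale1 : left_id 1 bop_scale.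
Proof. by move=> A; apply: bopP => x /=; rewrite scale1r. Qed.
Fact bop_scaleDr : right_distributive bop_scale +%R.
Proof. by move=> a A B; apply: bopP => x /=; rewrite scalerDr. Qed.
Fact bop_scaleDl A : {morph bop_scale^~ A : a b / a + b}.
Proof. by move=> a b; apply: bopP => x /=; rewrite scalerDl. Qed.
HB.instance Definition _ := GRing.Zmodule_isLmodule.Build R[i] (bop H)
  bop_scaleA bop_scale1 bop_scaleDr bop_scaleDl.

Definition bscalar a : bop H := a *: (1 : bop H).

Definition is_inverse A B := A * B = 1 /\ B * A = 1.
Definition invertible A := exists B, is_inverse A B.
(* 0 if A is not invertible. *)
Definition opinv A : bop H := xget 0 [set B | is_inverse A B].

Definition hermitian A := forall x y, hdot (A x) y = hdot x (A y).
Definition positive A := hermitian A /\ forall x, 0 <= hdot (A x) x.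
Definition opleq A B := positive (B - A).

(* Norms of vectors are elements of R[i], hence the real parts. *)
Definition opnorm A : R := sup [set complex.Re `|A x| | x in [set x | `|x| <= 1]].

Definition spectrum A : set R[i] := [set z | ~ invertible (A - bscalar z)].

End BopAlgebra.

Arguments bscalar {R H} a.

Section FunctionalCalculus.
Variables (R : realType) (H : hilbertType R).

Definition polyop (p : {poly R}) (A : bop H) : bop H :=
  \sum_(i < size p) (p`_i)%:C *: A ^+ i.

(* f(A) is the norm limit of p(A) for polynomials p converging to f uniformly
   on the spectrum of A. *)
Definition is_cfc (f : R -> R) (A T : bop H) :=
  forall e : R, 0 < e -> exists p : {poly R},
    (forall t : R, spectrum A t%:C -> `|p.[t] - f t| <= e) /\
    opnorm (polyop p A - T) <= e.

Definition cfc (f : R -> R) (A : bop H) : bop H := xget 0 [set T | is_cfc f A T].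

Definition spectrum_in (A : bop H) (J : interval R) :=
  forall z, spectrum A z -> exists2 t, t \in J & z = t%:C.

End FunctionalCalculus.

(* The quantification over K ranges over all complex Hilbert spaces, not only
   the one on which the connections act. *)
Definition operator_monotone (R : realType) (J : interval R) (f : R -> R) :=
  {within [set` J], continuous f} /\
  forall (K : hilbertType R) (A B : bop K), hermitian A -> hermitian B ->
    spectrum_in A J -> spectrum_in B J ->
    opleq A B -> opleq (cfc f A) (cfc f B).

(* OM(R^+): only the values on [0, +oo[ are meaningful. *)
Record omfun (R : realType) := OMFun {
  omfun_fun :> R -> R ;
  omfun_ge0 : forall x : R, 0 <= x -> 0 <= omfun_fun x ;
  omfun_monotone : operator_monotone `[0, +oo[ omfun_fun
}.

Definition omfun_norm (R : realType) (f : omfun R) : R := f 1.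

Record posop (R : realType) (H : hilbertType R) := PosOp {
  posop_val :> bop H ;
  posopP : positive posop_val
}.

Section Connections.
Variables (R : realType) (H : hilbertType R).

Fact positive_scale1 (x : R) : 0 <= x -> positive (bscalar x%:C : bop H).
Proof.
move=> x0; have xC0 : 0 <= x%:C by rewrite ler0c.
split=> [u v|u] /=.
  by rewrite linearZl_LR linearZr_LR /= (CrealP (ger0_real xC0)).
by rewrite linearZl_LR /= -hdot_norm mulr_ge0 // exprn_ge0.
Qed.

(* The operator x I. *)
Definition pscalar (x : R) (x0 : 0 <= x) : posop H := PosOp (positive_scale1 x0).

Fact positive_conj (C A : posop H) : positive ((C : bop H) * (A : bop H) * (C : bop H)).
Proof.
have [hC _] := posopP C; have [hA pA] := posopP A.
by split=> [u v|u] /=; [rewrite hC hA hC|rewrite hC].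
Qed.

Definition pconj (C A : posop H) : posop H := PosOp (positive_conj C A).

Definition sdecreasing_to (A_ : nat -> posop H) (A : posop H) :=
  (forall n, opleq (A_ n.+1) (A_ n)) /\
  (forall x : H, (fun n => A_ n x) @ \oo --> A x).

Record connection := Connection {
  conn_op :> posop H -> posop H -> posop H ;
  conn_monotone : forall A B C D : posop H,
    opleq A C -> opleq B D -> opleq (conn_op A B) (conn_op C D) ;
  conn_transformer : forall A B C : posop H,
    opleq (pconj C (conn_op A B)) (conn_op (pconj C A) (pconj C B)) ;
  conn_continuous : forall (A_ B_ : nat -> posop H) (A B : posop H),
    sdecreasing_to A_ A -> sdecreasing_to B_ B ->
    sdecreasing_to (fun n => conn_op (A_ n) (B_ n)) (conn_op A B)
}.

Definition conn_norm (s : connection) : R :=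
  sup [set r | exists A B : posop H,
    [/\ opnorm A = 1, opnorm B = 1 & r = opnorm (s A B)]].

Definition representing_function (s : connection) (f : omfun R) :=
  forall (x : R) (x0 : 0 <= x),
    bscalar (f x)%:C = s (pscalar ler01) (pscalar x0) :> bop H.

End Connections.

Definition zero_infty (R : realType) : set (\bar R) := `[0%E, +oo%E]%classic.
Arguments zero_infty R : clear implicits.

(* Encoded as the finite Borel measures on [-oo, +oo] carried by [0, +oo]. *)
Record bmeasure (R : realType) := BMeasure {
  bmeasure_val :> {finite_measure set (\bar R) -> \bar R} ;
  bmeasure_support : bmeasure_val (~` zero_infty R) = 0%E
}.

Definition bmeasure_norm (R : realType) (mu : bmeasure R) : R :=
  fine (mu (zero_infty R)).

Section RepresentingMeasure.
Variables (R : realType) (H : hilbertType R).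

Definition harmonic_inv (A B : bop H) : bop H :=
  2 *: opinv (opinv A + opinv B).

Definition is_harmonic_limit (A B T : bop H) :=
  forall x : H, (fun e : R =>
    harmonic_inv (A + bscalar e%:C) (B + bscalar e%:C) x) @ 0^'+ --> T x.

Definition harmonic (A B : bop H) : bop H :=
  if `[< invertible A /\ invertible B >] then harmonic_inv A B
  else xget 0 [set T | is_harmonic_limit A B T].

(* The endpoints take the limit values A at 0 and B at +oo. *)
Definition rep_integrand (A B : bop H) (l : \bar R) : bop H :=
  if l == 0%E then A else if l == +oo%E then B else
  ((fine l + 1) / (2 * fine l))%:C *: harmonic ((fine l)%:C *: A) B.

Definition representing_measure (s : connection H) (mu : bmeasure R) :=
  forall (A B : posop H) (x y : H),
    let g l := hdot (rep_integrand A B l x) y in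
    [/\ mu.-integrable (zero_infty R) (fun l => (complex.Re (g l))%:E),
        mu.-integrable (zero_infty R) (fun l => (complex.Im (g l))%:E) &
        hdot (s A B x) y = (\int[mu]_(l in zero_infty R) complex.Re (g l))
                       +i* (\int[mu]_(l in zero_infty R) complex.Im (g l))].

End RepresentingMeasure.

Definition norm_dist (R : realType) (T : Type) (N : T -> R) (x y : T) : R :=
  `| N x - N y |.

(* A copy of T carrying the topology of the pseudometric [norm_dist N]. *)
Definition norm_pm (R : realType) (T : Type) (N : T -> R) : Type := T.

Section NormPseudoMetric.
Variables (R : realType) (T : choiceType) (N : T -> R).

Definition norm_ball (x : T) (e : R) (y : T) : Prop := norm_dist N x y < e.

Fact norm_ball_center x (e : R) : 0 < e -> norm_ball x e x.
Proof. by rewrite /norm_ball /norm_dist subrr normr0. Qed.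

Fact norm_ball_sym x y e : norm_ball x e y -> norm_ball y e x.
Proof. by rewrite /norm_ball /norm_dist distrC. Qed.

Fact norm_ball_triangle x y z e1 e2 :
  norm_ball x e1 y -> norm_ball y e2 z -> norm_ball x (e1 + e2) z.
Proof.
rewrite /norm_ball /norm_dist => xy yz.
by apply: le_lt_trans (ler_distD (N y) _ _) _; apply: ltrD.
Qed.

HB.instance Definition _ := Choice.on (norm_pm N).
HB.instance Definition _ :=
  hasNbhs.Build (norm_pm N) (nbhs_ (entourage_ norm_ball)).
HB.instance Definition _ := Nbhs_isPseudoMetric.Build R (norm_pm N)
  erefl norm_ball_center norm_ball_sym norm_ball_triangle erefl.

End NormPseudoMetric.

HB.instance Definition _ (R : realType) (H : hilbertType R) :=
  gen_eqMixin (connection H).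
HB.instance Definition _ (R : realType) (H : hilbertType R) :=
  gen_choiceMixin (connection H).
HB.instance Definition _ (R : realType) (H : hilbertType R) :=
  PseudoMetric.copy (connection H) (norm_pm (@conn_norm R H)).

HB.instance Definition _ (R : realType) := gen_eqMixin (omfun R).
HB.instance Definition _ (R : realType) := gen_choiceMixin (omfun R).
HB.instance Definition _ (R : realType) :=
  PseudoMetric.copy (omfun R) (norm_pm (@omfun_norm R)).

HB.instance Definition _ (R : realType) := gen_eqMixin (bmeasure R).
HB.instance Definition _ (R : realType) := gen_choiceMixin (bmeasure R).
HB.instance Definition _ (R : realType) :=
  PseudoMetric.copy (bmeasure R) (norm_pm (@bmeasure_norm R)).

(* Main.v *)
(* All three norms agree: [conn_norm sigma = f 1 = mu [0, +oo]].  If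
   [|A| = |B| = 1] then [A, B <= I], so [A sigma B <= I sigma I = f(1) I] by
   monotonicity, with equality at [A = B = I]; and for [A = B = I] the
   integrand of the representing measure is constantly [I]. *)
Require Import Defs.
From mathcomp Require Import all_boot all_order all_algebra.
From mathcomp Require Import sesquilinear complex.
From mathcomp Require Import ring.
From mathcomp Require Import all_classical all_reals all_analysis.
From mathcomp Require Import measurable_realfun.
Import Order.TTheory GRing.Theory Num.Theory.
Import numFieldNormedType.Exports.
Local Open Scope classical_set_scope.
Local Open Scope complex_scope.
Local Open Scope ring_scope.

Lemma ltr0c (R : rcfType) (c : R) : (0 < c%:C) = (0 < c).
Proof. exact: (ltcR 0). Qed.

Section OperatorNorm.
Context {R : realType} {H : hilbertType R}.
Implicit Types (A T : bop H) (x : H) (c : R).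

Lemma bscalarE (a : R[i]) x : (bscalar a : bop H) x = a *: x.
Proof. by []. Qed.

(** [sup] defaults to 0 on a set without supremum, so [0 < opnorm A] certifies that the values on
    the unit ball are bounded. *)
Lemma opnorm_ge_unit A x : 0 < opnorm A -> `|x| <= 1 -> `|A x| <= (opnorm A)%:C.
Proof.
move=> A0 x1.
have [_ Aub] : has_sup [set complex.Re `|A y| | y in [set y | `|y| <= 1]].
  by apply: contrapT => /sup_out A0'; move: A0; rewrite /opnorm A0' ltxx.
rewrite -[`|A x|](RRe_real (normr_real _)) lecR.
by apply: ub_le_sup => //; exists x.
Qed.

Lemma opnorm_ge A x : 0 < opnorm A -> `|A x| <= (opnorm A)%:C * `|x|.
Proof.
move=> A0; have [->|x0] := eqVneq x 0; first by rewrite linear0 !normr0 mulr0.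
have nx0 : 0 < `|x| by rewrite normr_gt0.
have := @opnorm_ge_unit A (`|x|^-1 *: x) A0.
rewrite linearZ /= !normrZ normfV normr_id mulVf ?gt_eqF // => /(_ (lexx _)).
by rewrite mulrC ler_pdivrMr.
Qed.

Lemma opnorm_le A c : 0 <= c -> (forall x, `|A x| <= c%:C * `|x|) ->
  opnorm A <= c.
Proof.
move=> c0 Ac; apply: ge_sup.
  by exists (complex.Re `|A 0|), 0 => //=; rewrite normr0.
move=> _ [x /= x1 <-].
rewrite -lecR RRe_real ?normr_real //; apply: le_trans (Ac x) _.
by rewrite -[leRHS]mulr1 ler_wpM2l // ler0c.
Qed.

(* [0 <= |A x - x| ^+ 2] gives [2 <A x, x> <= |A x| ^+ 2 + |x| ^+ 2]. *)
Lemma positive_opleq1 A : positive A -> opnorm A = 1 ->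
  opleq A (bscalar 1%:C).
Proof.
move=> [hA pA] A1; split=> [x y|x] /=.
  by rewrite !bscalarE !scale1r linearBl linearBr /= hA.
rewrite bscalarE scale1r linearBl subr_ge0.
(* The cross term in [|A x - x| ^+ 2] is [<A x, x>] plus its conjugate; the two coincide because the
   number is real. *)
have dx : (hdot (A x) x)^* = hdot (A x) x by apply/CrealP/ger0_real.
have := dnorm_ge0 hdot (A x - x).
rewrite dnormB /= dx -!hdot_norm subr_ge0 => h.
have := @opnorm_ge A x; rewrite A1 mul1r => /(_ ltr01) Ax.
have : hdot (A x) x + hdot (A x) x <= `|x| ^+ 2 + `|x| ^+ 2.
  by apply: (le_trans h); rewrite lerD2r lerXn2r ?nnegrE.
by rewrite -!mulr2n lerMn2r.
Qed.

(* Positivity of [T (c - T) ^+ 2] and [T ^+ 2 (c - T)], whose sum is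
   [c ^+ 2 T - c T ^+ 2], bounds [c |T x| ^+ 2] by [c ^+ 2 <T x, x>]. *)
Lemma opnorm_le_pos T c : 0 < c -> positive T -> opleq T (bscalar c%:C) ->
  opnorm T <= c.
Proof.
move=> c0 [hT pT] [_ pc]; apply: (opnorm_le _ _ (ltW c0)) => x.
have cC0 : 0 < c%:C by rewrite ltr0c.
have cr : (c%:C)^* = c%:C by apply/CrealP/gtr0_real.
have T1 := pT (c%:C *: x - T x).
have T2 := pc (T x).
have T3 := pc x.
have := addr_ge0 T1 T2.
have -> : T (c%:C *: x - T x) = c%:C *: T x - T (T x).
  by rewrite linearB linearZ.
rewrite /= bscalarE !linearBl !linearBr /=.
rewrite !linearZl_LR !linearZr_LR /= cr -[_ *: (_ * _)]/(_ * (_ * _)).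
have -> : hdot (T (T x)) x = hdot (T x) (T x) by rewrite hT.
move: T3; rewrite /= bscalarE linearBl linearZl_LR /= -!hdot_norm subr_ge0.
set a := hdot (T x) x; set b := `|T x| ^+ 2; set d := hdot (T (T x)) (T x).
move=> T3 h.
have {}h : c%:C * b <= c%:C * (c%:C * a).
  by rewrite -subr_ge0; apply: etrans h; congr (0 <= _); ring.
(* Cancelling [c] leaves [b <= c a], and [T3] says [a <= c |x| ^+ 2]; together they give
   [|T x| ^+ 2 <= c ^+ 2 |x| ^+ 2]. *)
rewrite ler_pM2l // in h.
rewrite -(@ler_pXn2r _ 2) ?nnegrE ?mulr_ge0 ?(ltW cC0) // exprMn.
by rewrite -/b (le_trans h) // expr2 -mulrA ler_pM2l.
Qed.

Lemma opnorm_le_opleq T c : 0 <= c -> positive T ->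
  opleq T (bscalar c%:C) -> opnorm T <= c.
Proof.
(* The strict version cancels a factor [c]; using it at [c + e] for every [e > 0] also covers
   [c = 0]. *)
move=> c0 pT Tc; apply/ler_addgt0Pr => e e0; apply: opnorm_le_pos => //.
  by rewrite ltr_wpDl.
have [h1 p1] := Tc; have [h2 p2] := positive_scale1 H (ltW e0).
rewrite /opleq.
suff -> : bscalar (c + e)%:C - T = (bscalar c%:C - T) + bscalar e%:C.
  split=> [x y|x] /=; first by rewrite linearDl linearDr /= h1 h2.
  rewrite linearDl; apply: addr_ge0; [exact: p1|exact: p2].
by rewrite rmorphD /bscalar scalerDl addrAC.
Qed.

Hypothesis H_neq0 : exists x : H, x != 0.

(** A normalised nonzero vector attains the supremum; on the zero space every [opnorm] would be 0,
    even that of the identity. *)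
Lemma opnorm_bscalar c : 0 <= c -> opnorm (bscalar c%:C : bop H) = c.
Proof.
move=> c0; apply/eqP; rewrite eq_le; apply/andP; split.
  by apply: opnorm_le => // x; rewrite bscalarE normrZ ger0_norm ?ler0c.
have [x x0] := H_neq0.
have nx0 : 0 < `|x| by rewrite normr_gt0.
apply: ub_le_sup; last first.
  exists (`|x|^-1 *: x) => /=.
    by rewrite normrZ normfV normr_id mulVf ?gt_eqF.
  rewrite bscalarE !normrZ normfV normr_id mulVf ?gt_eqF // mulr1.
  by rewrite ger0_norm ?ler0c.
exists c => _ [y /= y1 <-].
rewrite -lecR RRe_real ?normr_real // bscalarE normrZ ger0_norm ?ler0c //.
by rewrite -[leRHS]mulr1 ler_wpM2l // ler0c.
Qed.

End OperatorNorm.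

Lemma conn_normE {R : realType} {H : hilbertType R} (s : connection H)
    (f : omfun R) : (exists x : H, x != 0) -> representing_function s f ->
  conn_norm s = omfun_norm f.
Proof.
move=> H0 sf; rewrite /omfun_norm.
have f0 : 0 <= f 1 by apply: omfun_ge0.
have s11 := sf 1 ler01; rewrite /conn_norm.
set S := [set r | _].
(* [f 1] bounds [S] and belongs to it, so the supremum is a maximum and not the default value of
   [sup]. *)
have Sub : ubound S (f 1).
  move=> _ [A [B [A1 B1 ->]]]; apply: opnorm_le_opleq => //.
    exact: posopP.
  rewrite s11; apply: conn_monotone; apply: positive_opleq1 => //;
    exact: posopP.
have Sf : S (f 1).
  exists (pscalar H ler01), (pscalar H ler01).
  by rewrite /= -s11 !opnorm_bscalar.
apply/eqP; rewrite eq_le; apply/andP; split.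
  by apply: ge_sup => //; exists (f 1).
by apply: ub_le_sup => //; exists (f 1).
Qed.

Section RepresentingMeasureOfIdentity.
Context {R : realType} {H : hilbertType R}.

(** Two-sided inverses are unique, which determines the choice made by [xget]. *)
Lemma opinvE (A B : bop H) : is_inverse A B -> opinv A = B.
Proof.
move=> [AB BA]; apply: xget_unique => // C [AC CA].
by rewrite -[C]mulr1 -AB mulrA CA mul1r.
Qed.

Lemma is_inverse_bscalar (a : R[i]) : a != 0 ->
  is_inverse (bscalar a : bop H) (bscalar a^-1).
Proof.
by move=> a0; split; apply: bopP => x; rewrite /= !bscalarE scalerA;
  rewrite ?mulVf ?mulfV // scale1r.
Qed.

Lemma harmonic_bscalar (a b : R) : 0 < a -> 0 < b ->
  Defs.harmonic (bscalar a%:C : bop H) (bscalar b%:C) =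
  bscalar (2 * (a%:C^-1 + b%:C^-1)^-1).
Proof.
move=> a0 b0; have aC0 : 0 < a%:C by rewrite ltr0c.
have bC0 : 0 < b%:C by rewrite ltr0c.
have ia := is_inverse_bscalar _ (lt0r_neq0 aC0).
have ib := is_inverse_bscalar _ (lt0r_neq0 bC0).
(* Both scalars are invertible, so the explicit formula applies and no strong limit arises. *)
rewrite /Defs.harmonic asboolT; last first.
  by split; [exists (bscalar a%:C^-1) | exists (bscalar b%:C^-1)].
rewrite /harmonic_inv (opinvE _ _ ia) (opinvE _ _ ib) -scalerDl.
rewrite (opinvE _ _ (is_inverse_bscalar _ _)) ?scalerA //.
by rewrite gt_eqF // addr_gt0 // invr_gt0.
Qed.

(** The endpoint values are [I] by convention; in between, [l I ! I = 2 l / (l + 1) I] cancels the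
    weight [(l + 1) / (2 l)]. *)
Lemma rep_integrand1 (l : \bar R) : zero_infty R l ->
  rep_integrand (bscalar 1%:C : bop H) (bscalar 1%:C) l = bscalar 1%:C.
Proof.
rewrite /zero_infty /= in_itv /= => /andP[l0 _]; rewrite /rep_integrand.
case: eqP => // /eqP ln0; case: eqP => // /eqP lny.
case: l l0 ln0 lny => [l||] //= l0 ln0 _.
have {ln0}l0 : 0 < l by rewrite lt_neqAle eq_sym -lee_fin l0 andbT.
have lC0 : l%:C != 0 by rewrite gt_eqF // ltr0c.
have lD0 : l%:C + 1 != 0 by rewrite gt_eqF // addr_gt0 // ltr0c.
have -> : l%:C *: (bscalar 1%:C : bop H) = bscalar l%:C.
  by rewrite /bscalar scalerA mulr1.
rewrite harmonic_bscalar // /bscalar scalerA; congr (_ *: _).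
rewrite rmorphM /= fmorphV rmorphD !rmorphM /= rmorph1 rmorph_nat.
by field; rewrite lC0 addrC lD0.
Qed.

(** Testing the weak integral at [A = B = I] on one nonzero [x] in both slots gives [f 1 <x, x> =
    <x, x> mu [0, +oo]], and [<x, x>] cancels. *)
Lemma bmeasure_normE (s : connection H) (f : omfun R) (mu : bmeasure R) :
  (exists x : H, x != 0) -> representing_function s f ->
  representing_measure s mu -> bmeasure_norm mu = omfun_norm f.
Proof.
move=> [x x0] sf /(_ (pscalar H ler01) (pscalar H ler01) x x)[_ _].
rewrite -sf /= bscalarE linearZl_LR /=.
have hx : hdot x x = (complex.Re (hdot x x))%:C.
  by rewrite RRe_real // -hdot_norm ger0_real.
have hx0 : complex.Re (hdot x x) != 0.
  apply/eqP => h; move: x0; rewrite -(dnorm_eq0 hdot) hx h.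
  by rewrite eqxx.
move=> /(congr1 (@complex.Re R)) /=.
rewrite (@eq_Rintegral _ _ _ _ _ (fun=> complex.Re (hdot x x))); last first.
  move=> l /set_mem l0; rewrite rep_integrand1 // bscalarE.
  by rewrite scale1r.
rewrite Rintegral_cst; last exact: emeasurable_itv.
by rewrite hx /= mul0r subr0 mulrC => /(mulfI hx0).
Qed.

End RepresentingMeasureOfIdentity.

(** The pseudometric sees a point only through its norm, so matching norms yield the same ball
    conditions even in different cones. *)
Lemma cvg_norm_pm {R : realType} {T U : choiceType} (N : T -> R) (M : U -> R)
    (x_ : nat -> T) (x : T) (y_ : nat -> U) (y : U) :
  (forall n, N (x_ n) = M (y_ n)) -> N x = M y ->
  ((x_ : nat -> norm_pm N) @ \oo --> (x : norm_pm N)) <->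
  ((y_ : nat -> norm_pm M) @ \oo --> (y : norm_pm M)).
Proof.
move=> NM NMx.
have E n e : ball (x : norm_pm N) e (x_ n) = ball (y : norm_pm M) e (y_ n).
  by rewrite /ball /= /norm_ball /norm_dist NM NMx.
split=> /cvg_ballP h; apply/cvg_ballP => e /h; apply: filterS => n.
  by rewrite E.
by rewrite E.
Qed.

Theorem corollary3p6 (R : realType) (H : hilbertType R)
    (H_neq0 : exists x : H, x != 0)
    (sigma_ : nat -> connection H) (f_ : nat -> omfun R)
    (mu_ : nat -> bmeasure R)
    (sigma : connection H) (f : omfun R) (mu : bmeasure R)
    (hf_ : forall n, representing_function (sigma_ n) (f_ n))
    (hmu_ : forall n, representing_measure (sigma_ n) (mu_ n))
    (hf : representing_function sigma f)
    (hmu : representing_measure sigma mu) :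
  (sigma_ @ \oo --> sigma <-> f_ @ \oo --> f) /\
  (f_ @ \oo --> f <-> mu_ @ \oo --> mu).
Proof.
split.
  (* The topology of each cone is that of [norm_pm] by conversion; only the norms have to be
     named. *)
  apply: (@cvg_norm_pm R _ _ (@conn_norm R H) (@omfun_norm R)).
    by move=> n; apply: conn_normE.
  exact: conn_normE.
apply: (@cvg_norm_pm R _ _ (@omfun_norm R) (@bmeasure_norm R)).
  by move=> n; rewrite (bmeasure_normE (sigma_ n) (f_ n)).
by rewrite (bmeasure_normE sigma f).
Qed.
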